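(* Let $m,s$ be positive integers such that $m\ge 2$ and $0<s<m$. Then $$\frac{(q^s,q^{2m-s},q^{2m};q^{2m})_\infty\,(q^{2m-2s},q^{2m+2s};q^{4m})_\infty}{(q^s,q^{m-s};q^{m})_\infty}=\sum_{n=-\infty}^\infty q^{n(mn+s)}.$$
   Context: Here $(a;q)_\infty:=\prod_{j=0}^{\infty}(1-aq^j)$ and $(a_1,a_2,\ldots,a_j;q)_\infty:=(a_1;q)_\infty(a_2;q)_\infty\cdots(a_j;q)_\infty$. Throughout, $q$ is a complex number with $|q|<1$ (equivalently, identities may be read as identities of formal power series in $q$). *)

(* Defs.v *)
From mathcomp Require Import all_boot all_order all_algebra.
From mathcomp Require Import all_classical all_reals all_analysis.
From mathcomp Require Import complex.
Set Implicit Arguments.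
Unset Strict Implicit.
Unset Printing Implicit Defensive.

Import Order.TTheory GRing.Theory Num.Theory.
Import numFieldNormedType.Exports.

Local Open Scope classical_set_scope.
Local Open Scope ring_scope.

(* The definitions are over an abstract numFieldType K because the topology
   induced by the norm is inferred from that structure; it is not found by
   inference directly on R[i]. *)

(* (a; q)_oo *)
Definition qpoch (K : numFieldType) (a q : K) : K :=
  limn (fun N : nat => \prod_(0 <= j < N) (1 - a * q ^+ j)).

(* (a_1, ..., a_k; q)_oo for as_ = [:: a_1; ...; a_k] *)
Definition qpochs (K : numFieldType) (as_ : seq K) (q : K) : K :=
  \prod_(a <- as_) qpoch a q.

(* A bilateral series converges when both of its halves, n >= 0 and n < 0,
   do; limn is only meaningful under this condition. *)
Definition cvg_bilateral (K : numFieldType) (f : int -> K) : Prop :=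
  cvgn (series (fun n : nat => f n%:Z)) /\
  cvgn (series (fun n : nat => f (- n.+1%:Z))).

Definition bilateral_sum (K : numFieldType) (f : int -> K) : K :=
  limn (series (fun n : nat => f n%:Z)) +
  limn (series (fun n : nat => f (- n.+1%:Z))).

(* Main.v *)
Require Import Defs.
From mathcomp Require Import all_boot all_order all_algebra.
From mathcomp Require Import all_classical all_reals all_analysis.
From mathcomp Require Import complex ring lra zify.
Set Implicit Arguments.
Unset Strict Implicit.
Unset Printing Implicit Defensive.

Import Order.TTheory GRing.Theory Num.Theory.
Import numFieldNormedType.Exports.
Import Normc.

Local Open Scope ring_scope.
Local Open Scope classical_set_scope.

(** Put Q = q^m, z = q^s, a = zQ, b = Q/z, so that ab = Q^2 and both a and b are
    positive powers of q.  The quotient of products collapses: splitting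
    (z; Q) and (Q/z; Q) into their factors of even and odd index
    ([qpoch_split]) turns the denominator into
    (z, a, b, Q^2/z; Q^2), while (b^2, a^2; Q^4) = (b, -b, a, -a; Q^2) by
    difference of squares ([qpoch_sqr]).  What survives is
    (Q^2, -a, -b; Q^2), and the identity becomes Jacobi's triple product for
    the sum of Q^(n^2) z^n, i.e. for Ramanujan's theta function f(a, b).

    The triple product ([jacobi_triple_product]) is the limit of a finite
    identity.  The product of the 2N factors 1 + a p^j, 1 + b p^j with j < N
    and p = ab is the sum over -N <= n <= N of the n-th term of f(a, b) weighted
    by the Gaussian binomial coefficient [2N, N + n]_p ([finite_jtp_sym]); this
    follows from the q-Pascal rule by adding one factor at a time, and holds
    without dividing by a or b, hence also when q = 0.  As N grows, each
    weight tends to 1/(p; p) with an infinite product, and all of them are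
    bounded by one constant because (p; p)_N converges to a nonzero limit.  The
    terms of f(a, b) are dominated by geometric series, so the limit may be
    taken termwise by Tannery's theorem ([tannery]).

    Convergence of complex sequences is reduced to the real modulus [normc]
    ([cvg_normcP]).  An absolutely convergent series converges, by looking at
    real and imaginary parts ([cvg_series_normc]), and this yields convergence
    of infinite products ([cvg_prod1D]); they do not vanish because the
    products of the inverse factors converge too ([qpoch_neq0]). *)

(** * Finite form of the Jacobi triple product *)

Definition qpochn (K : numFieldType) (a q : K) (N : nat) : K :=
  \prod_(0 <= j < N) (1 - a * q ^+ j).

Lemma qpochnS (K : numFieldType) (a q : K) N :
  qpochn a q N.+1 = qpochn a q N * (1 - a * q ^+ N).
Proof. by rewrite /qpochn big_nat_recr. Qed.

(** Gaussian binomial coefficients as quotients, rather than by Pascal's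
    recursion: the limits of their factors are then visible.  The factors
    1 - p^j must not vanish; this is the recurring hypothesis below, true for
    p of modulus less than 1. *)
Definition qbinom (K : numFieldType) (p : K) (n k : nat) : K :=
  if (k <= n)%N then qpochn p p n / (qpochn p p k * qpochn p p (n - k)) else 0.

Lemma qbinomC (K : numFieldType) (p : K) n k :
  (k <= n)%N -> qbinom p n (n - k) = qbinom p n k.
Proof. by move=> kn; rewrite /qbinom leq_subr kn subKn// [X in _ / X]mulrC. Qed.

Lemma qpochn_neq0 (K : numFieldType) (p : K) n :
  (forall k, 1 - p ^+ k.+1 != 0) -> qpochn p p n != 0.
Proof.
move=> p1.
by rewrite /qpochn prodf_seq_neq0; apply/allP => j _ /=; rewrite -exprS.
Qed.

Lemma qbinom0 (K : numFieldType) (p : K) n :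
  (forall k, 1 - p ^+ k.+1 != 0) -> qbinom p n 0 = 1.
Proof.
move=> p1.
by rewrite /qbinom subn0 {2}/qpochn big_geq// mul1r divff ?qpochn_neq0.
Qed.

Lemma qbinomS (K : numFieldType) (p : K) n k :
  (forall i, 1 - p ^+ i.+1 != 0) -> (k <= n)%N ->
  qbinom p n.+1 k.+1 = qbinom p n k.+1 + p ^+ (n - k) * qbinom p n k.
Proof.
move=> p1 kn; rewrite /qbinom ltnS kn subSS.
case: ltnP => [kltn|nk]; last first.
  have -> : k = n by apply/eqP; rewrite eqn_leq kn.
  rewrite subnn /qpochn (@big_geq _ _ _ 0 0)// !mulr1 !divff ?qpochn_neq0//.
  by rewrite add0r mulr1.
have -> : (n - k = (n - k.+1).+1)%N by lia.
set d := (n - k.+1)%N.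
have -> : n = (k + d).+1 by rewrite /d; lia.
rewrite !qpochnS -!exprS.
have := qpochn_neq0 k p1; have := qpochn_neq0 d p1; have := p1 k; have := p1 d.
rewrite -addnS -addSn !exprD.
move: (qpochn p p k) (qpochn p p d) (qpochn p p (k + d)) => x y z.
move: (p ^+ k.+1) (p ^+ d.+1) => u v.
by move=> ? ? ? ?; field; repeat (apply/andP; split).
Qed.

(** The general term a^(n(n+1)/2) b^(n(n-1)/2) of Ramanujan's theta function
    f(a, b).  Its value at -n is the value at n with a and b exchanged, so
    that the terms of negative index need no inverses of a and b. *)
Definition theta_term (K : numFieldType) (a b : K) (n : nat) : K :=
  a ^+ 'C(n.+1, 2) * b ^+ 'C(n, 2).

Lemma theta_termS (K : numFieldType) (a b : K) n :
  theta_term a b n.+1 = a * (a * b) ^+ n * theta_term a b n.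
Proof.
rewrite /theta_term (binS n.+1) (binS n 1) !bin1.
rewrite exprMn !exprD exprS; ring.
Qed.

(** The terms of f(a, b) listed from index -N on: entry k is the term of index
    k - N. *)
Definition btheta_term (K : numFieldType) (a b : K) (N k : nat) : K :=
  if (N <= k)%N then theta_term a b (k - N) else theta_term b a (N - k).

(** The terms t_n of f(a, b) satisfy t_(n+1) = a p^n t_n for all integers n,
    where p = ab.  Written as a p^M t_n = p^(M-n) t_(n+1) with n <= M, the
    relation has no negative exponent, also when n < 0. *)
Lemma btheta_termS (K : numFieldType) (p a b : K) M N k :
  a * b = p -> (k <= M + N)%N ->
  a * p ^+ M * btheta_term a b N k = p ^+ (M + N - k) * btheta_term a b N k.+1.
Proof.
move=> ab kMN; rewrite /btheta_term; case: (leqP N k) => Nk.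
  rewrite (leqW Nk) subSn// theta_termS ab.
  have -> : (M = M + N - k + (k - N))%N by lia.
  have -> : ((M + N - k + (k - N)) + N - k = M + N - k)%N by lia.
  by rewrite exprD; ring.
have -> : (N - k = (N - k.+1).+1)%N by lia.
rewrite theta_termS [b * a]mulrC ab.
have -> : (M + N - k = M + (N - k.+1).+1)%N by lia.
rewrite exprD exprS; move: (p ^+ M) (p ^+ (N - k.+1)) => u v.
rewrite -ab; case: leqP => h; last by ring.
have -> : k.+1 = N by lia.
rewrite subnn /theta_term/= !bin_small// !expr0; ring.
Qed.

(** Multiplying by the new factor 1 + a p^M adds to each sum its translate by
    one index, weighted by p^(M-n) ([btheta_termS]); this is what the q-Pascal
    rule needs. *)
Lemma finite_jtp_step (K : numFieldType) (p a b : K) M N :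
  (forall n, 1 - p ^+ n.+1 != 0) -> a * b = p ->
  qpochn (- a) p M * qpochn (- b) p N =
    \sum_(0 <= k < (M + N).+1) qbinom p (M + N) k * btheta_term a b N k ->
  qpochn (- a) p M.+1 * qpochn (- b) p N =
    \sum_(0 <= k < (M.+1 + N).+1) qbinom p (M.+1 + N) k * btheta_term a b N k.
Proof.
move=> p1 ab S; rewrite qpochnS mulNr opprK mulrAC S mulrDr mulr1 mulr_suml.
rewrite [RHS]big_nat_recl// addSn qbinom0// mul1r.
under [X in _ = _ + X]eq_big_nat => k kn do
  rewrite qbinomS ?(andP kn).2// mulrDl mulrAC -btheta_termS//.
rewrite big_split addrA/=; congr (_ + _); last first.
  by apply: eq_bigr => k _; ring.
rewrite big_nat_recl// qbinom0// mul1r; congr (_ + _).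
rewrite big_nat_recr//= {3}/qbinom ltnn mul0r addr0//.
Qed.

(** It is enough to let the first product grow: exchanging a and b reverses the
    sum and exchanges M and N, so the case M = 0 follows from the case
    N = 0. *)
Lemma finite_jtp (K : numFieldType) (p a b : K) M N :
  (forall n, 1 - p ^+ n.+1 != 0) -> a * b = p ->
  qpochn (- a) p M * qpochn (- b) p N =
    \sum_(0 <= k < (M + N).+1) qbinom p (M + N) k * btheta_term a b N k.
Proof.
move=> p1; have H0 c d n : c * d = p -> qpochn (- c) p n * qpochn (- d) p 0 =
    \sum_(0 <= k < (n + 0).+1) qbinom p (n + 0) k * btheta_term c d 0 k.
  move=> cd; elim: n => [|n IHn]; last exact: finite_jtp_step.
  rewrite big_nat1 /qpochn !big_geq// qbinom0// /btheta_term/= /theta_term.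
  by rewrite !bin_small// !expr0 !mulr1.
move=> ab; elim: M => [|M IHM]; last exact: finite_jtp_step.
rewrite mulrC H0; last by rewrite mulrC.
rewrite addn0 add0n big_nat_rev/= add0n.
apply: eq_big_nat => k /andP[_ kN]; rewrite subSS.
rewrite qbinomC// /btheta_term leq0n subn0.
case: leqP => h; last by [].
have -> : k = N by lia.
by rewrite subnn /theta_term !bin_small// !expr0.
Qed.

(** The case M = N, with the indices n >= 0 and n < 0 separated and both
    sums indexed outwards from the center, ready for the limit in N. *)
Lemma finite_jtp_sym (K : numFieldType) (p a b : K) N :
  (forall n, 1 - p ^+ n.+1 != 0) -> a * b = p ->
  qpochn (- a) p N * qpochn (- b) p N =
    \sum_(0 <= n < N.+1) qbinom p (N + N) (N + n) * theta_term a b n +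
    \sum_(0 <= n < N) qbinom p (N + N) (N + n.+1) * theta_term b a n.+1.
Proof.
move=> p1 ab.
rewrite (finite_jtp _ _ p1 ab) (@big_cat_nat _ _ _ N)//=; last by lia.
rewrite addrC; congr (_ + _).
  rewrite -{1}(add0n N) big_addn -addnS addKn.
  by apply: eq_bigr => n _; rewrite /btheta_term leq_addl addnK addnC.
rewrite big_nat_rev/= add0n; apply: eq_big_nat => n /andP[_ nN].
rewrite /btheta_term ifN; last by lia.
rewrite subKn// -qbinomC; last by lia.
by congr (qbinom _ _ _ * _); lia.
Qed.

(** * Limits of complex sequences *)

Local Notation C R := (complex R : numFieldType).

(** Limit rules with the field itself as codomain, so that they apply to [C R]
    without choosing a normed module structure on it. *)
Lemma cvgn_unique (K : numFieldType) (u : nat -> K) (l l' : K) :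
  u @ \oo --> l -> u @ \oo --> l' -> l = l'.
Proof. by move=> ul ul'; exact: (norm_cvg_unique ul ul'). Qed.

Lemma cvgnD (K : numFieldType) (u v : nat -> K) (a b : K) :
  u @ \oo --> a -> v @ \oo --> b -> (fun n => u n + v n) @ \oo --> a + b.
Proof. by move=> ua vb; exact: cvgD. Qed.

Lemma cvgnM (K : numFieldType) (u v : nat -> K) (a b : K) :
  u @ \oo --> a -> v @ \oo --> b -> (fun n => u n * v n) @ \oo --> a * b.
Proof. by move=> ua vb; exact: cvgM. Qed.

Lemma cvgnV (K : numFieldType) (u : nat -> K) (a : K) :
  a != 0 -> u @ \oo --> a -> (fun n => (u n)^-1) @ \oo --> a^-1.
Proof. by move=> a0 ua; exact: cvgV. Qed.

Lemma cvgn_eventually (K : numFieldType) (u v : nat -> K) (l : K) (k : nat) :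
  (forall N, (k <= N)%N -> u N = v N) -> u @ \oo --> l -> v @ \oo --> l.
Proof.
move=> uv; apply: cvg_trans; apply: near_eq_cvg.
by exists k => // N /= /uv ->.
Qed.

Lemma normc_ge0 (R : realType) (z : R[i]) : 0 <= normc z.
Proof. by case: z => a b; exact: sqrtr_ge0. Qed.

Lemma normcX (R : realType) (z : R[i]) n : normc (z ^+ n) = normc z ^+ n.
Proof.
elim: n => [|n IHn]; first by rewrite !expr0 normc1.
by rewrite !exprS normcM IHn.
Qed.

Lemma normc_sum (R : realType) (n : nat) (y : nat -> R[i]) :
  normc (\sum_(0 <= k < n) y k) <= \sum_(0 <= k < n) normc (y k).
Proof. exact: (@ler_norm_sum R (Rcomplex R)). Qed.

(** The norm of [C R] takes values in [C R]; comparing it with the real-valued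
    modulus gives access to the order completeness of [R]. *)
Lemma cvg_normcP (R : realType) (u : nat -> C R) (l : C R) :
  u @ \oo --> l <-> (fun n => normc (u n - l)) @ \oo --> (0 : R).
Proof.
have normE (z : C R) : `|z| = (normc z)%:C%C by case: z.
split=> [/cvgrPdist_lt ul | /cvgrPdist_lt ul].
  apply/cvgrPdist_lt => e e0.
  have /ul : 0 < e%:C%C :> C R by rewrite ltcR.
  apply: filterS => n; rewrite normE ltcR sub0r normrN.
  by rewrite ger0_norm ?normc_ge0// -normcN opprB.
apply/cvgrPdist_lt => e; case: e => e f; rewrite ltcE/= => /andP[/eqP -> e0].
have := ul _ e0; apply: filterS => n; rewrite normE ltcR sub0r normrN.
by rewrite ger0_norm ?normc_ge0// -normcN opprB.
Qed.

Lemma ler_abs_Re_normc (R : realType) (z : R[i]) : `|complex.Re z| <= normc z.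
Proof.
by case: z => a b /=; rewrite -sqrtr_sqr ler_wsqrtr// lerDl sqr_ge0.
Qed.

Lemma ler_abs_Im_normc (R : realType) (z : R[i]) : `|complex.Im z| <= normc z.
Proof.
by case: z => a b /=; rewrite -sqrtr_sqr ler_wsqrtr// lerDr sqr_ge0.
Qed.

Lemma cvg_series_normc (R : realType) (y : nat -> C R) :
  cvgn (series (fun n => normc (y n))) -> cvgn (series y).
Proof.
move=> cy.
have cRe : cvgn (series (fun n => complex.Re (y n))).
  apply: (@normed_cvg R R^o).
  apply: (series_le_cvg _ _ _ cy) => n; [exact: normr_ge0| exact: normc_ge0|].
  exact: ler_abs_Re_normc.
have cIm : cvgn (series (fun n => complex.Im (y n))).
  apply: (@normed_cvg R R^o).
  apply: (series_le_cvg _ _ _ cy) => n; [exact: normr_ge0| exact: normc_ge0|].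
  exact: ler_abs_Im_normc.
set a := limn _ in cRe; set b := limn _ in cIm.
pose l : C R := (a +i* b)%C.
apply: (cvgP l); apply/cvg_normcP.
have normle (z : R[i]) : normc z <= `|complex.Re z| + `|complex.Im z|.
  case: z => x z; rewrite /normc/=.
  rewrite -(ger0_norm (addr_ge0 (normr_ge0 x) (normr_ge0 z))) -sqrtr_sqr.
  rewrite ler_wsqrtr// sqrrD !real_normK ?num_real// lerD2r lerDl.
  by rewrite mulrn_wge0// mulr_ge0.
pose v n := `|series (fun n => complex.Re (y n)) n - a| +
            `|series (fun n => complex.Im (y n)) n - b|.
apply: (@squeeze_cvgr _ _ _ R (fun=> 0) v).
- apply: nearW => n; rewrite normc_ge0/=; apply: le_trans (normle _) _.
  rewrite /v /series/= !raddfB/=.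
  rewrite (raddf_sum (@complex.Re R : Rcomplex R -> R)).
  by rewrite (raddf_sum (@complex.Im R : Rcomplex R -> R)).
- exact: cvg_cst.
- have dist0 (w : R^nat) (c : R) : w @ \oo --> c ->
      (fun n => `|w n - c|) @ \oo --> (0 : R).
    move=> wc; rewrite -(@normr0 _ R) -(subrr c).
    by apply: cvg_norm; apply: cvgB => //; exact: cvg_cst.
  by rewrite -(addr0 0); apply: cvgD; apply: dist0.
Qed.

(** * Series, Tannery's theorem and infinite products *)

(** Dominated convergence for series.  The error is at most the sum of
    g N n = |a N n - l n|, where g N n <= 2 M n: cut it at an index k beyond
    which the tail of 2 M is small; the first k terms tend to 0 with N.  The
    number h N of summands need only tend to infinity. *)
Lemma tannery (R : realType) (a : nat -> nat -> C R) (l : nat -> C R)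
    (M : nat -> R) (h : nat -> nat) :
  h @ \oo --> \oo -> cvgn (series M) ->
  (forall N n, normc (a N n) <= M n) ->
  (forall n, (fun N => a N n) @ \oo --> l n) ->
  (fun N => \sum_(0 <= n < h N) a N n) @ \oo --> limn (series l).
Proof.
move=> hoo cM aM al.
have M0 n : 0 <= M n by apply: le_trans (aM 0%N n); exact: normc_ge0.
pose g N n := normc (a N n - l n).
have g0 n : (fun N => g N n) @ \oo --> (0 : R) by apply/cvg_normcP; exact: al.
have lM n : normc (l n) <= M n.
  apply/ler_addgt0Pr => e e0.
  have /cvgrPdist_lt/(_ _ e0)[N _ /(_ N (leqnn N))] := g0 n.
  rewrite /= sub0r normrN ger0_norm ?normc_ge0// => /ltW gN.
  have -> : l n = a N n + - (a N n - l n) by rewrite opprB addrC subrK.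
  apply: le_trans (le_normcD _ _) _; rewrite lerD// ?aM//.
  by rewrite (normcN (a N n - l n)).
have gM N n : g N n <= 2 * M n.
  apply: le_trans (le_normcD _ _) _; rewrite (normcN (l n)).
  by rewrite mulr2n mulrDl !mul1r lerD.
have cl : series l @ \oo --> limn (series l).
  apply: cvg_series_normc; apply: (series_le_cvg _ M0 lM cM) => n.
  exact: normc_ge0.
suff D0 : (fun N => \sum_(0 <= n < h N) a N n - series l (h N)) @ \oo -->
    (0 : C R).
  have hl := cvg_comp _ _ hoo cl.
  rewrite -[limn _]add0r.
  have -> : (fun N => \sum_(0 <= n < h N) a N n) =
      (fun N => \sum_(0 <= n < h N) a N n - series l (h N) + series l (h N)).
    by apply/funext => N; rewrite subrK.
  exact: (cvgnD D0 hl).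
apply/cvg_normcP.
apply: (@squeeze_cvgr _ _ _ R (fun=> 0) (fun N => \sum_(0 <= n < h N) g N n)).
- apply: nearW => N; rewrite normc_ge0/= subr0 -sumrB; exact: normc_sum.
- exact: cvg_cst.
apply/cvgrPdist_lt => e e0.
have e4 : 0 < e / 4 by rewrite divr_gt0.
have SM m : series M m <= limn (series M).
  apply: nondecreasing_cvgn_le => //.
  exact: nondecreasing_series.
have /cvgrPdist_lt/(_ _ e4)[k _ /(_ k (leqnn k))] := cM.
rewrite /= ger0_norm ?subr_ge0// => kM.
have hk : \forall N \near \oo, (k <= h N)%N by exact: (hoo _ (nbhs_infty_ge k)).
have head0 : (fun N => \sum_(0 <= n < k) g N n) @ \oo --> (0 : R).
  elim: k {kM hk} => [|k IHk].
    under eq_fun do rewrite big_geq//; exact: cvg_cst.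
  under eq_fun do rewrite big_nat_recr//=.
  by have := cvgD IHk (g0 k) => /(_ _); rewrite addr0; apply.
have e2 : 0 < e / 2 by rewrite divr_gt0.
have /cvgrPdist_lt/(_ _ e2) head := head0.
near=> N.
have kN : (k <= h N)%N by near: N.
rewrite sub0r normrN ger0_norm; last first.
  by apply: sumr_ge0 => n _; exact: normc_ge0.
rewrite (@big_cat_nat _ _ _ k)//=.
have tail : \sum_(k <= n < h N) g N n <= 2 * (limn (series M) - series M k).
  apply: (@le_trans _ _ (2 * \sum_(k <= n < h N) M n)).
    by rewrite mulr_sumr; apply: ler_sum => n _; exact: gM.
  rewrite ler_pM2l// lerBrDl.
  by have := SM (h N); rewrite /series/= (@big_cat_nat _ _ _ k).
have : `|0 - \sum_(0 <= n < k) g N n| < e / 2 by near: N.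
rewrite sub0r normrN ger0_norm; last first.
  by apply: sumr_ge0 => n _; exact: normc_ge0.
lra.
Unshelve. all: by end_near.
Qed.

(** The partial products P are bounded by the exponential of the sum of the
    moduli of y, and P (n+1) - P n = P n * y n, so the increments of P are
    absolutely summable. *)
Lemma cvg_prod1D (R : realType) (y : nat -> C R) :
  cvgn (series (fun n => normc (y n))) ->
  cvgn (fun N => \prod_(0 <= j < N) (1 + y j)).
Proof.
move=> cy; set P := fun N => _.
pose S := limn (series (fun n => normc (y n))).
have PS N : normc (P N) <= expR S.
  apply: (@le_trans _ _ (expR (\sum_(0 <= j < N) normc (y j)))).
    elim: N => [|N IHN]; first by rewrite /P !big_geq// normc1 expR0.
    rewrite /P !big_nat_recr//= normcM expRD ler_pM ?normc_ge0//.
    apply: le_trans (expR_ge1Dx _); apply: le_trans (le_normcD _ _) _.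
    by rewrite (normc1 R).
  rewrite ler_expR.
  apply: (@nondecreasing_cvgn_le _ (series (fun n => normc (y n)))) => //.
  by apply: nondecreasing_series => n _ _; exact: normc_ge0.
have cT : cvgn (series (telescope P)).
  apply: cvg_series_normc.
  apply: (@series_le_cvg _ _ (fun n => expR S * normc (y n))).
  - by move=> n; exact: normc_ge0.
  - by move=> n; rewrite mulr_ge0 ?expR_ge0 ?normc_ge0.
  - move=> n; rewrite /telescope /P/= big_nat_recr//= mulrDr mulr1 addrC addKr.
    by rewrite normcM ler_wpM2r ?normc_ge0//; exact: PS.
  - exact: (@is_cvg_seriesZ R _ (expR S) cy).
have -> : P = (fun N => P 0%N + series (telescope P) N).
  by apply/funext => N; exact: eq_sum_telescope.
have c0 : (fun=> P 0%N) @ \oo --> (P 0%N : C R) by exact: cvg_cst.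
exact: (cvgP _ (cvgnD c0 cT)).
Qed.

Lemma cvg_geometric_normc (R : realType) (q : C R) (c : R) :
  normc q < 1 -> cvgn (series (fun n => c * normc q ^+ n)).
Proof.
move=> q1; apply: is_cvg_geometric_series.
by rewrite ger0_norm ?normc_ge0.
Qed.

Lemma cvg_qpochn (R : realType) (a q : C R) :
  normc q < 1 -> qpochn a q @ \oo --> qpoch a q.
Proof.
move=> q1; apply: (@cvg_prod1D _ (fun j => - (a * q ^+ j))).
under eq_fun do rewrite (normcN (_ * _)) normcM normcX.
exact: cvg_geometric_normc.
Qed.

(** The inverses of the factors are 1 + y j with y dominated by a geometric
    series, as |1 - a q^j| >= 1 - |a|.  Their product converges, and its limit
    is an inverse of (a; q). *)
Lemma qpoch_neq0 (R : realType) (a q : C R) :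
  normc a < 1 -> normc q < 1 -> qpoch a q != 0.
Proof.
move=> a1 q1.
have low j : 1 - normc a <= normc (1 - a * q ^+ j).
  rewrite lerBlDr -(normc1 R).
  rewrite -[X in normc X <= _](subrK (a * q ^+ j)).
  apply: le_trans (le_normcD _ _) _; rewrite lerD2l normcM normcX.
  by rewrite ler_piMr ?normc_ge0// exprn_ile1 ?normc_ge0 ?ltW.
have nz j : 1 - a * q ^+ j != 0.
  apply: contraTneq (low j) => ->; rewrite normc0 -ltNge subr_gt0//.
pose y j := a * q ^+ j / (1 - a * q ^+ j).
have yE j : (1 - a * q ^+ j)^-1 = 1 + y j.
  by rewrite /y -{1}(subrK (a * q ^+ j) 1) -{1}(mulVf (nz j)); field; exact: nz.
have : cvgn (fun N => \prod_(0 <= j < N) (1 + y j)).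
  apply: cvg_prod1D.
  apply: (@series_le_cvg _ _ (fun n => normc a / (1 - normc a) * normc q ^+ n)).
  - by move=> n; exact: normc_ge0.
  - move=> n; rewrite mulr_ge0 ?exprn_ge0 ?divr_ge0 ?normc_ge0//.
    by rewrite subr_ge0 ltW.
  - move=> n; rewrite /y !normcM normcV normcX [leRHS]mulrAC ler_wpM2l//.
      by rewrite mulr_ge0 ?exprn_ge0 ?normc_ge0.
    by rewrite lef_pV2 ?posrE ?subr_gt0// (lt_le_trans _ (low n))// subr_gt0.
  - exact: cvg_geometric_normc.
move=> /(cvgnM (@cvg_qpochn R a q q1)); set L' := limn _ => PL.
have : qpoch a q * L' = 1.
  apply: (cvgn_unique PL).
  suff -> : (fun N => qpochn a q N * \prod_(0 <= j < N) (1 + y j)) = fun=> 1.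
    exact: cvg_cst.
  apply/funext => N /=; rewrite /qpochn -big_split/=; apply: big1 => j _.
  by rewrite -yE divff.
by move=> PL1; apply: contra_eqN PL1 => /eqP ->; rewrite mul0r eq_sym oner_eq0.
Qed.

(** * The Jacobi triple product *)

Lemma normc_bounded (R : realType) (u : nat -> C R) (l : C R) :
  u @ \oo --> l -> exists B, forall n, normc (u n) <= B.
Proof.
move=> /cvg_normcP /(cvgP _) /cvg_has_ub [B ubB].
exists (B + normc l) => n.
have -> : u n = (u n - l) + l by rewrite subrK.
apply: le_trans (le_normcD _ _) _; rewrite lerD2r.
apply: ubB; exists n => //=; exact: (ger0_norm (normc_ge0 _)).
Qed.

(** For N >= n the coefficient is (p; p)_(2N) / ((p; p)_(N+n) (p; p)_(N-n)), and
    the three factors have the same nonzero limit. *)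
Lemma cvg_qbinom_center (R : realType) (p : C R) (n : nat) : normc p < 1 ->
  (fun N => qbinom p (N + N) (N + n)) @ \oo --> (qpoch p p)^-1.
Proof.
move=> p1.
have P0 := qpoch_neq0 p1 p1; have cP := @cvg_qpochn R p p p1.
have cPD k : (fun N => qpochn p p (N + k)) @ \oo --> qpoch p p.
  by apply: cvg_comp cP; exact: cvg_addnr.
have cPB : (fun N => qpochn p p (N - n)) @ \oo --> qpoch p p.
  by apply: cvg_comp cP; exact: cvg_subnr.
have cPN : (fun N => qpochn p p (N + N)) @ \oo --> qpoch p p.
  by under eq_fun do rewrite addnn -muln2; apply: cvg_comp cP; exact: cvg_mulnr.
have PP0 : qpoch p p * qpoch p p != 0 by rewrite mulf_neq0.
have := cvgnM cPN (cvgnV PP0 (cvgnM (cPD n) cPB)).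
have -> : qpoch p p / (qpoch p p * qpoch p p) = (qpoch p p)^-1.
  by field.
apply: (cvgn_eventually (k := n)) => N /= nN.
rewrite /qbinom leq_add2l nN /=; congr (_ / (_ * qpochn p p _)); lia.
Qed.

Lemma qbinom_bounded (R : realType) (p : C R) : normc p < 1 ->
  exists B, forall n k, normc (qbinom p n k) <= B.
Proof.
move=> p1; have P0 := qpoch_neq0 p1 p1; have cP := @cvg_qpochn R p p p1.
have [B PB] := normc_bounded cP.
have [D VD] := normc_bounded (cvgnV P0 cP).
have B0 : 0 <= B by apply: le_trans (PB 0%N); exact: normc_ge0.
have D0 : 0 <= D by apply: le_trans (VD 0%N); exact: normc_ge0.
exists (B * (D * D)) => n k; rewrite /qbinom; case: ifP => _; last first.
  by rewrite normc0 !mulr_ge0.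
by rewrite invfM !normcM !ler_pM ?mulr_ge0 ?normc_ge0//; exact: VD.
Qed.

(** The exponent n(n+1)/2 of a is at least n. *)
Lemma theta_term_le (R : realType) (a b : C R) n :
  normc a < 1 -> normc b < 1 -> normc (theta_term a b n) <= normc a ^+ n.
Proof.
move=> a1 b1; rewrite /theta_term binS bin1 normcM !normcX exprD.
rewrite -mulrA mulrCA ler_piMr ?exprn_ge0 ?normc_ge0//.
by rewrite mulr_ile1 ?exprn_ge0 ?exprn_ile1 ?normc_ge0 ?ltW.
Qed.

Lemma cvg_theta_series (R : realType) (a b : C R) :
  normc a < 1 -> normc b < 1 -> cvgn (series (theta_term a b)).
Proof.
move=> a1 b1; apply: cvg_series_normc.
apply: (@series_le_cvg _ _ (fun n => 1 * normc a ^+ n)).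
- by move=> n; exact: normc_ge0.
- by move=> n; rewrite mul1r exprn_ge0 ?normc_ge0.
- by move=> n; rewrite mul1r theta_term_le.
- exact: cvg_geometric_normc.
Qed.

Lemma cvg_theta_seriesS (R : realType) (a b : C R) :
  normc a < 1 -> normc b < 1 -> cvgn (series (fun n => theta_term a b n.+1)).
Proof.
move=> a1 b1; apply: cvg_series_normc.
apply: (@series_le_cvg _ _ (fun n => normc a * normc a ^+ n)).
- by move=> n; exact: normc_ge0.
- by move=> n; rewrite -exprS exprn_ge0 ?normc_ge0.
- by move=> n; rewrite -exprS theta_term_le.
- exact: cvg_geometric_normc.
Qed.

(** Both halves of [finite_jtp_sym] converge by [tannery]; the factor 1/(p; p)
    common to the limits of the weights moves to the other side. *)
Lemma jacobi_triple_product (R : realType) (a b : C R) :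
  normc a < 1 -> normc b < 1 ->
  qpoch (a * b) (a * b) * (qpoch (- a) (a * b) * qpoch (- b) (a * b)) =
    limn (series (theta_term a b)) +
    limn (series (fun n => theta_term b a n.+1)).
Proof.
move=> a1 b1; set p := a * b.
have p1 : normc p < 1.
  by rewrite normcM (le_lt_trans _ a1)// ler_piMr ?normc_ge0 ?ltW.
have p1N n : 1 - p ^+ n.+1 != 0.
  rewrite subr_eq0; apply: contraTneq p1 => p1.
  have : normc p ^+ n.+1 == 1 by rewrite -normcX -p1 normc1.
  by rewrite -leNgt pexprn_eq1 ?normc_ge0//= => /eqP ->.
have P0 := qpoch_neq0 p1 p1.
have [B PB] := qbinom_bounded p1.
have term_le c d N k n : normc c < 1 -> normc d < 1 ->
    normc (qbinom p N k * theta_term c d n) <= B * normc c ^+ n.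
  move=> c1 d1; rewrite normcM ler_pM ?normc_ge0//.
  exact: theta_term_le.
have cpos : (fun N => \sum_(0 <= n < N.+1)
      qbinom p (N + N) (N + n) * theta_term a b n) @ \oo -->
    limn (series (fun n => (qpoch p p)^-1 * theta_term a b n)).
  apply: (@tannery _ _ _ (fun n => B * normc a ^+ n) S).
  - rewrite (_ : S = addn^~ 1%N); first exact: cvg_addnr.
    by apply/funext => n; rewrite addn1.
  - exact: cvg_geometric_normc.
  - by move=> N n; exact: term_le.
  - move=> n; apply: cvgnM; [exact: cvg_qbinom_center|exact: cvg_cst].
have cneg : (fun N => \sum_(0 <= n < N)
      qbinom p (N + N) (N + n.+1) * theta_term b a n.+1) @ \oo -->
    limn (series (fun n => (qpoch p p)^-1 * theta_term b a n.+1)).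
  apply: (@tannery _ _ _ (fun n => B * normc b * normc b ^+ n) id).
  - exact: cvg_id.
  - exact: cvg_geometric_normc.
  - by move=> N n; rewrite -mulrA -exprS; exact: term_le.
  - move=> n; apply: cvgnM; [exact: cvg_qbinom_center|exact: cvg_cst].
have limZ (u : nat -> C R) (c : C R) : cvgn (series u) ->
    limn (series (fun n => c * u n)) = c * limn (series u).
  exact: (@lim_seriesZ (C R)).
have c1 := cvg_theta_series a1 b1.
have c2 := cvg_theta_seriesS b1 a1.
have cprod := cvgnM (@cvg_qpochn R (- a) p p1) (@cvg_qpochn R (- b) p p1).
have csum := cvgnD cpos cneg.
rewrite (limZ _ (qpoch p p)^-1 c1) in csum.
rewrite (limZ _ (qpoch p p)^-1 c2) in csum.
rewrite -mulrDr in csum.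
have -> : qpoch (- a) p * qpoch (- b) p = (qpoch p p)^-1 *
    (limn (series (theta_term a b)) +
     limn (series (fun n => theta_term b a n.+1))).
  apply: (cvgn_unique cprod).
  rewrite (_ : (fun _ => _ * _) = fun N : nat =>
    (\sum_(0 <= n < N.+1) qbinom p (N + N) (N + n) * theta_term a b n +
     \sum_(0 <= n < N) qbinom p (N + N) (N + n.+1) * theta_term b a n.+1))//.
  by apply/funext => N /=; exact: finite_jtp_sym.
by rewrite mulrA divff// mul1r.
Qed.

(** * The identity *)

Lemma qpoch_split (R : realType) (a q : C R) : normc q < 1 ->
  qpoch a q = qpoch a (q ^+ 2) * qpoch (a * q) (q ^+ 2).
Proof.
move=> q1.
have q21 : normc (q ^+ 2) < 1 by rewrite normcX exprn_ilt1 ?normc_ge0.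
have even : (fun N => qpochn a q (N * 2)) @ \oo --> qpoch a q.
  by apply: cvg_comp (cvg_qpochn q1); exact: cvg_mulnr.
apply: (cvgn_unique even).
rewrite (_ : (fun N => _) =
  fun N => qpochn a (q ^+ 2) N * qpochn (a * q) (q ^+ 2) N).
  by apply: cvgnM; exact: cvg_qpochn.
apply/funext; elim=> [|N IHN]; first by rewrite /qpochn !big_geq// mulr1.
by rewrite mulSn add2n !qpochnS IHN -!exprM (mulnC N) (exprS q (2 * N)); ring.
Qed.

Lemma qpoch_sqr (R : realType) (a q : C R) : normc q < 1 ->
  qpoch (a ^+ 2) (q ^+ 2) = qpoch a q * qpoch (- a) q.
Proof.
move=> q1.
have q21 : normc (q ^+ 2) < 1 by rewrite normcX exprn_ilt1 ?normc_ge0.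
apply: (cvgn_unique (@cvg_qpochn _ (a ^+ 2) _ q21)).
rewrite (_ : qpochn _ _ = fun N => qpochn a q N * qpochn (- a) q N).
  by apply: cvgnM; exact: cvg_qpochn.
apply/funext => N; rewrite /qpochn -big_split/=; apply: eq_bigr => j _.
by rewrite exprAC; ring.
Qed.

Lemma bin2_double n : (2 * 'C(n, 2) + n = n * n)%N.
Proof. by elim: n => // n; rewrite binS bin1; lia. Qed.

(** With a = q^(m+s) and b = q^(m-s), the exponent of q is
    m (n(n+1)/2 + n(n-1)/2) + s (n(n+1)/2 - n(n-1)/2) = m n^2 + s n. *)
Lemma theta_term_expn (K : numFieldType) (q : K) (m s n : nat) : (s <= m)%N ->
  theta_term (q ^+ (m + s)) (q ^+ (m - s)) n = q ^+ (n * (m * n + s)).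
Proof.
move=> sm; rewrite /theta_term -!exprM -exprD; congr (_ ^+ _).
have bin2E := bin2_double n.
have [d ->] : exists d, (m = d + s)%N by exists (m - s)%N; lia.
rewrite binS bin1 addnK; move: 'C(n, 2) bin2E => c bin2E.
have := congr1 (muln d) bin2E; have := congr1 (muln s) bin2E; lia.
Qed.

Lemma theta_term_expnN (K : numFieldType) (q : K) (m s n : nat) : (s <= m)%N ->
  theta_term (q ^+ (m - s)) (q ^+ (m + s)) n = q ^+ (n * (m * n - s)).
Proof.
move=> sm; rewrite /theta_term -!exprM -exprD; congr (_ ^+ _).
have bin2E := bin2_double n.
case: n bin2E => [|n bin2E]; first by rewrite !bin_small// !muln0.
rewrite (binS _.+1) bin1.
move: 'C(n.+1, 2) bin2E => c bin2E.
have [d mE] : exists d, (m = d + s)%N by exists (m - s)%N; lia.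
have -> : (m * n.+1 - s = m * n + d)%N by nia.
rewrite mE addnK.
have := congr1 (muln d) bin2E; have := congr1 (muln s) bin2E; lia.
Qed.

Theorem theorem5p1 (R : realType) (q : R[i]) (m s : nat)
    (hq : `|q| < 1) (hm : (2 <= m)%N) (hs : (0 < s < m)%N) :
  let theta := fun n : int => q ^ (n * (m%:Z * n + s%:Z)) in
  [/\ qpochs [:: q ^+ s; q ^+ (m - s)] (q ^+ m) != 0,
      cvg_bilateral theta &
      qpochs [:: q ^+ s; q ^+ (2 * m - s); q ^+ (2 * m)] (q ^+ (2 * m))
      * qpochs [:: q ^+ (2 * m - 2 * s); q ^+ (2 * m + 2 * s)] (q ^+ (4 * m))
      / qpochs [:: q ^+ s; q ^+ (m - s)] (q ^+ m)
      = bilateral_sum theta].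
Proof.
move=> theta; have /andP[s0 sm] := hs.
have q1 : normc q < 1 by move: hq; rewrite -ltcR; case: (q).
have qX k : (0 < k)%N -> normc (q ^+ k) < 1.
  by move=> k0; rewrite normcX exprn_ilt1 ?normc_ge0// -lt0n.
pose a : C R := q ^+ (m + s); pose b : C R := q ^+ (m - s).
have a1 : normc a < 1 by apply: qX; lia.
have b1 : normc b < 1 by apply: qX; lia.
have thetaP : (fun n : nat => theta n%:Z) = theta_term a b.
  apply/funext => n.
  by rewrite theta_term_expn ?(ltnW sm)// exprnP PoszM PoszD PoszM.
have thetaN : (fun n : nat => theta (- n.+1%:Z)) = fun n => theta_term b a n.+1.
  apply/funext => n; rewrite theta_term_expnN ?(ltnW sm)// exprnP PoszM.
  rewrite -subzn; last by nia.
  by rewrite PoszM /theta mulrN mulNr -mulrN opprD opprK.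
have nz k l : (0 < k)%N -> (0 < l)%N -> qpoch (q ^+ k : C R) (q ^+ l) != 0.
  by move=> k0 l0; apply: qpoch_neq0; exact: qX.
have m0 : (0 < m)%N by lia.
rewrite /qpochs !big_cons !big_nil !mulr1; split.
- by rewrite mulf_neq0//; apply: nz; lia.
- rewrite /cvg_bilateral thetaP thetaN; split; first exact: cvg_theta_series.
  exact: cvg_theta_seriesS.
rewrite /bilateral_sum thetaP thetaN -jacobi_triple_product//.
have -> : a * b = q ^+ (2 * m) by rewrite -exprD; congr (_ ^+ _); lia.
have -> : q ^+ (2 * m - 2 * s) = b ^+ 2 by rewrite -exprM; congr (_ ^+ _); lia.
have -> : q ^+ (2 * m + 2 * s) = a ^+ 2 by rewrite -exprM; congr (_ ^+ _); lia.
have -> : q ^+ (4 * m) = (q ^+ (2 * m)) ^+ 2.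
  by rewrite -exprM; congr (_ ^+ _); lia.
rewrite !qpoch_sqr ?qX ?muln_gt0//.
rewrite (qpoch_split (q ^+ s) (qX _ m0)) (qpoch_split (q ^+ (m - s)) (qX _ m0)).
rewrite -!exprM -!exprD (mulnC m 2%N).
have -> : (m - s + m = 2 * m - s)%N by lia.
rewrite [(s + m)%N]addnC -/a -/b.
have h1 : qpoch (q ^+ s : C R) (q ^+ (2 * m)) != 0 by apply: nz; lia.
have h2 : qpoch (q ^+ (2 * m - s) : C R) (q ^+ (2 * m)) != 0 by apply: nz; lia.
have h3 : qpoch a (q ^+ (2 * m)) != 0 by apply: nz; lia.
have h4 : qpoch b (q ^+ (2 * m)) != 0 by apply: nz; lia.
(* The infinite products are treated as indeterminates, so that the field
   normalisation does not look into them. *)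
have cancel (x y u v u' v' w : C R) : x != 0 -> y != 0 -> u != 0 -> v != 0 ->
    x * (y * w) * (v * v' * (u * u')) / (x * u * (v * y)) = w * (u' * v').
  by move=> *; field; do ?(apply/andP; split).
move: h1 h2 h3 h4; do 7!move: (qpoch _ _) => ?.
exact: cancel.
Qed.
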